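(* Let $\lambda,\mu,\nu$ be algebraic units of degree $p,q,r$ over $\mathbb{Q}$ respectively, with conjugates $\{\lambda_i\}_{i=1}^p$, $\{\mu_j\}_{j=1}^q$, $\{\nu_k\}_{k=1}^r$, such that for all $i,j,k$ one has $|\lambda_i|\neq1$, $|\mu_j|\neq1$, $|\nu_k|\neq1$, $|\lambda_i\mu_j|\neq1$, $|\lambda_i\nu_k|\neq1$ and $|\mu_j\nu_k|\neq1$. Let $\mathfrak{n}$ be the (complex) Lie algebra with basis $$\beta=\{X_{(i,j,k)},\,Y_j,\,Z_k,\,V_{(i,k)},\,W_{(i,j)},\,U_i : 1\le i\le p,\ 1\le j\le q,\ 1\le k\le r\}$$ and Lie bracket given by $$[X_{(i,j,k)},Y_m]=\delta_{j,m}V_{(i,k)},\quad [X_{(i,j,k)},Z_n]=\delta_{k,n}W_{(i,j)},\quad [Z_n,V_{(i,k)}]=\delta_{n,k}U_i,\quad [Y_m,W_{(i,j)}]=\delta_{m,j}U_i,$$ all other brackets of basis elements being zero (up to skew-symmetry). Let $A$ be the linear transformation of $\mathfrak{n}$ that is diagonal in the basis $\beta$, with eigenvalues $\lambda_i\mu_j\nu_k$ on $X_{(i,j,k)}$, $\mu_j^{-1}$ on $Y_j$, $\nu_k^{-1}$ on $Z_k$, $\lambda_i\nu_k$ on $V_{(i,k)}$, $\lambda_i\mu_j$ on $W_{(i,j)}$, and $\lambda_i$ on $U_i$. Then: (a) $\mathfrak{n}$ is a three-step nilpotent Lie algebra (the Jacobi identity holds) of type $(pqr+q+r,\ pr+pq,\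 p)$. (b) $A$ is a hyperbolic automorphism of $\mathfrak{n}$. (c) The vectors $$\mathcal{X}_{(m,l,s)}=\sum_{i=1}^{p}\sum_{j=1}^{q}\sum_{k=1}^{r}\lambda_i^{m}\mu_j^{l}\nu_k^{s}X_{(i,j,k)},\quad \mathcal{Y}_l=\sum_{j=1}^{q}\mu_j^{-l}Y_j,\quad \mathcal{Z}_s=\sum_{k=1}^{r}\nu_k^{-s}Z_k,$$ $$\mathcal{V}_{(m,s)}=\sum_{i=1}^{p}\sum_{k=1}^{r}\lambda_i^{m}\nu_k^{s}V_{(i,k)},\quad \mathcal{W}_{(m,l)}=\sum_{i=1}^{p}\sum_{j=1}^{q}\lambda_i^{m}\mu_j^{l}W_{(i,j)},\quad \mathcal{U}_m=\sum_{i=1}^{p}\lambda_i^{m}U_i,$$ with $0\le m<p$, $0\le l<q$, $0\le s<r$, form a $\mathbb{Z}$-basis of $\mathfrak{n}$ preserved by $A$. Therefore $\mathfrak{n}$ is an Anosov Lie algebra.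
   Context: A $\mathbb{Z}$-basis of a Lie algebra is a basis with integer structure constants; it is preserved by $A$ if the matrix of $A$ in that basis lies in $\mathrm{GL}_n(\mathbb{Z})$, where $n$ is the dimension. An automorphism is hyperbolic if none of its eigenvalues has modulus $1$. A real Lie algebra of dimension $n$ is Anosov if and only if it admits a hyperbolic automorphism whose matrix with respect to some $\mathbb{Z}$-basis lies in $\mathrm{GL}_n(\mathbb{Z})$ (equivalently, it has a rational form admitting a hyperbolic automorphism whose matrix in some basis is in $\mathrm{GL}_n(\mathbb{Z})$). Here the algebra is constructed over $\mathbb{C}$ so as to work with eigenvectors, and it is called Anosov in the sense that it admits a hyperbolic automorphism whose matrix lies in $\mathrm{GL}_n(\mathbb{Z})$ with respect to a $\mathbb{Z}$-basis. The type of a nilpotent Lie algebra $\mathfrak{n}$ is the tuple $(n_1,\dots,n_t)$ with $n_i=\dim C^{i-1}(\mathfrak{n})/C^i(\mathfrak{n})$, where $C^0(\mathfrak{n})=\mathfrak{n}$, $C^{i}(\mathfrak{n})=[\mathfrak{n},C^{i-1}(\mathfrak{n})]$, and $C^t(\mathfrak{n})=0\ne C^{t-1}(\mathfrak{n})$. The symbol $\delta$ is the Kronecker delta.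
   Formalization: In (b), hyperbolicity of A is asserted only when |λ_iμ_jν_k| ≠ 1 for all i,j,k; without this it fails, e.g. λ=φ, μ=φ², ν=φ⁻³ (φ the golden ratio) gives eigenvalue λμν=1. Everything else, including that n is Anosov, is proved under the original hypotheses. *)

(* Defs.v *)
From HB Require Import structures.
From mathcomp Require Import all_boot all_order all_algebra.
From mathcomp Require Import reals complex.

Set Implicit Arguments.
Unset Strict Implicit.
Unset Printing Implicit Defensive.

Import Order.TTheory GRing.Theory Num.Theory.

Local Open Scope ring_scope.

Section LieAlgebras.

Variables (K : fieldType) (V : vectType K).
Implicit Types (br : V -> V -> V) (A : 'End(V)).

Definition lie_bracket br : Prop :=
  [/\ forall y, linear (br^~ y),
      forall x, linear (br x),
      forall x, br x x = 0
    & forall x y z, br x (br y z) + br y (br z x) + br z (br x y) = 0].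

(* [U, W]: by bilinearity it suffices to take brackets of basis vectors. *)
Definition brv br (U W : {vspace V}) : {vspace V} :=
  <<[seq br u w | u <- vbasis U, w <- vbasis W]>>%VS.

(* lcs br i is C^i(n): C^0(n) = n and C^(i+1)(n) = [n, C^i(n)]. *)
Definition lcs br (i : nat) : {vspace V} := iter i (brv br fullv) fullv.

Definition nilpotent_step br (t : nat) : Prop :=
  [/\ (0 < t)%N, lcs br t = 0%VS & lcs br t.-1 <> 0%VS].

(* The series is decreasing, so the truncated difference of dimensions is the
   dimension of C^i / C^(i+1); the i-th entry of s (counted from 0) is the
   n_(i+1) of the type. *)
Definition lie_type br (s : seq nat) : Prop :=
  nilpotent_step br (size s) /\
  s = [seq (\dim (lcs br i) - \dim (lcs br i.+1))%N | i <- iota 0 (size s)].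

Definition lie_automorphism br A : Prop :=
  bijective A /\ forall x y, A (br x y) = br (A x) (A y).

Definition Zbasis br (I : finType) (e : I -> V) : Prop :=
  basis_of fullv [seq e i | i : I] /\
  forall i j, exists c : I -> int, br (e i) (e j) = \sum_k (c k)%:~R *: e k.

(* Column j of M holds the coordinates of the image of the j-th basis vector;
   M \in unitmx over int is membership in GL_n(Z). *)
Definition preserves_Zbasis A (I : finType) (e : I -> V) : Prop :=
  exists2 M : 'M[int]_#|I|, M \in unitmx &
    forall j, A (e (enum_val j)) = \sum_i (M i j)%:~R *: e (enum_val i).

End LieAlgebras.

Definition hyperbolic (C : numClosedFieldType) (V : vectType C)
    (A : 'End(V)) : Prop :=
  forall a : C, passmx.leigenvalue A a -> `|a| != 1.

Definition Anosov (C : numClosedFieldType) (V : vectType C)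
    (br : V -> V -> V) : Prop :=
  lie_bracket br /\
  exists A : 'End(V), [/\ lie_automorphism br A, hyperbolic A &
    exists (I : finType) (e : I -> V), Zbasis br e /\ preserves_Zbasis A e].

Section AlgebraicNumbers.

Variable C : numClosedFieldType.
Implicit Types x z : C.

Definition algebraic_unit x : Prop :=
  [/\ x != 0, integralOver (intr : int -> C) x
    & integralOver (intr : int -> C) x^-1].

(* The monic generator of the ideal of rational polynomials vanishing at x. *)
Definition is_minpoly (P : {poly rat}) x : Prop :=
  P \is monic /\ forall Q : {poly rat}, root (map_poly ratr Q) x = (P %| Q).

Definition degree_over_Q x (n : nat) : Prop :=
  exists P, is_minpoly P x /\ size P = n.+1.

Definition conjugate_over_Q x z : Prop :=
  exists P, is_minpoly P x /\ root (map_poly ratr P) z.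

(* c lists the conjugates of x, each exactly once. *)
Definition conjugates x (n : nat) (c : 'I_n -> C) : Prop :=
  injective c /\ forall z, conjugate_over_Q x z <-> exists i, z = c i.

End AlgebraicNumbers.

Inductive beta (p q r : nat) : Type :=
| BX of 'I_p & 'I_q & 'I_r
| BY of 'I_q
| BZ of 'I_r
| BV of 'I_p & 'I_r
| BW of 'I_p & 'I_q
| BU of 'I_p.

Arguments BX {p q r}.
Arguments BY {p q r}.
Arguments BZ {p q r}.
Arguments BV {p q r}.
Arguments BW {p q r}.
Arguments BU {p q r}.

Section BetaFinite.

Variables p q r : nat.

Let code : Type :=
  ('I_p * 'I_q * 'I_r + 'I_q + 'I_r + 'I_p * 'I_r + 'I_p * 'I_q + 'I_p)%type.

Definition beta_encode (a : beta p q r) : code :=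
  match a with
  | BX i j k => inl (inl (inl (inl (inl (i, j, k)))))
  | BY j => inl (inl (inl (inl (inr j))))
  | BZ k => inl (inl (inl (inr k)))
  | BV i k => inl (inl (inr (i, k)))
  | BW i j => inl (inr (i, j))
  | BU i => inr i
  end.

Definition beta_decode (c : code) : beta p q r :=
  match c with
  | inl (inl (inl (inl (inl (i, j, k))))) => BX i j k
  | inl (inl (inl (inl (inr j)))) => BY j
  | inl (inl (inl (inr k))) => BZ k
  | inl (inl (inr (i, k))) => BV i k
  | inl (inr (i, j)) => BW i j
  | inr i => BU i
  end.

Lemma beta_encodeK : cancel beta_encode beta_decode.
Proof. by case. Qed.

HB.instance Definition _ := Finite.copy (beta p q r) (can_type beta_encodeK).

End BetaFinite.

Section TheAlgebra.

Variables (K : fieldType) (p q r : nat).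

(* The vector space with basis beta; K^o is K as a module over itself. *)
Definition nspace : vectType K := {ffun beta p q r -> K^o}.

Definition bvec (a : beta p q r) : nspace := [ffun b => (b == a)%:R].

Definition half_bracket (a b : beta p q r) : nspace :=
  match a, b with
  | BX i j k, BY m => (j == m)%:R *: bvec (BV i k)
  | BX i j k, BZ n => (k == n)%:R *: bvec (BW i j)
  | BZ n, BV i k => (n == k)%:R *: bvec (BU i)
  | BY m, BW i j => (m == j)%:R *: bvec (BU i)
  | _, _ => 0
  end.

(* Bilinear extension of the skew-symmetrized table; half_bracket a b and
   half_bracket b a are never both nonzero. *)
Definition nbracket (x y : nspace) : nspace :=
  \sum_a \sum_b (x a * y b) *: (half_bracket a b - half_bracket b a).

Definition diag_fun (d : beta p q r -> K) (x : nspace) : nspace :=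
  [ffun a => d a * x a].

Lemma diag_fun_linear d : linear (diag_fun d).
Proof.
by move=> c x y; apply/ffunP => a; rewrite !ffunE mulrDr mulrCA.
Qed.

HB.instance Definition _ d :=
  GRing.isSemilinear.Build K nspace nspace _ (diag_fun d)
    (GRing.semilinear_linear (diag_fun_linear d)).

Definition diag_end (d : beta p q r -> K) : 'End(nspace) :=
  linfun (diag_fun d).

Lemma diag_endE d a : diag_end d (bvec a) = d a *: bvec a.
Proof.
rewrite lfunE; apply/ffunP => b; rewrite !ffunE.
by case: eqP => [->//|_]; rewrite !mulr0 scaler0.
Qed.

Variables (la : 'I_p -> K) (mu : 'I_q -> K) (nu : 'I_r -> K).

Definition eigA (a : beta p q r) : K :=
  match a with
  | BX i j k => la i * mu j * nu k
  | BY j => (mu j)^-1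
  | BZ k => (nu k)^-1
  | BV i k => la i * nu k
  | BW i j => la i * mu j
  | BU i => la i
  end.

(* The script vectors of the integral basis, the exponents m, l, s being the
   values of the ordinals. *)
Definition Zvec (a : beta p q r) : nspace :=
  match a with
  | BX m l s => \sum_i \sum_j \sum_k
                  (la i ^+ m * mu j ^+ l * nu k ^+ s) *: bvec (BX i j k)
  | BY l => \sum_j mu j ^- l *: bvec (BY j)
  | BZ s => \sum_k nu k ^- s *: bvec (BZ k)
  | BV m s => \sum_i \sum_k (la i ^+ m * nu k ^+ s) *: bvec (BV i k)
  | BW m l => \sum_i \sum_j (la i ^+ m * mu j ^+ l) *: bvec (BW i j)
  | BU m => \sum_i la i ^+ m *: bvec (BU i)
  end.

End TheAlgebra.

Arguments nbracket {K p q r}.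

(* Main.v *)
Require Import Defs.
From mathcomp Require Import all_boot all_order all_algebra.
From mathcomp Require Import reals complex.
From mathcomp Require Import ring.

(** Let c_1, ..., c_n be the conjugates of an algebraic unit of degree n.  By
    Gauss's lemma its minimal polynomial is integral, and its inverse is an
    integer polynomial in it; hence for every m in Z there are integers a_k
    with c_i^m = sum_(k<n) a_k c_i^k, the same a_k for all i.  So applying a
    diagonal map with eigenvalues la_i^x mu_j^y nu_k^z to a script vector gives
    an integral combination of script vectors, for all integers x, y, z; since
    the inverse has the same shape, the matrix is in GL_n(Z).  Brackets of
    script vectors contract a power of mu or nu against another one, which
    leaves the trace of a power of a unit, an integer.

    The products la_i mu_j nu_k may have modulus 1, in which case A itself is
    not hyperbolic.  The Anosov property is then witnessed by replacing nu_k by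
    nu_k^n in the eigenvalues, keeping the same Z-basis: each condition on
    moduli excludes at most one n because |nu_k| <> 1. *)

Set Implicit Arguments.
Unset Strict Implicit.
Unset Printing Implicit Defensive.

Import Order.TTheory GRing.Theory Num.Theory.

Local Open Scope ring_scope.

(** * Units, their conjugates, and integral combinations of powers *)

Section PowerCombinations.

Variables (K0 : comNzRingType) (C : fieldType) (phi : {rmorphism K0 -> C}).

(** The coefficients do not depend on [i]. Taking [K0] to be [int] expresses integrality; taking
    [K0] to be [C] serves to invert the change of basis. *)
Definition power_comb (n : nat) (c f : 'I_n -> C) : Prop :=
  exists a : 'I_n -> K0, forall i, f i = \sum_(m < n) phi (a m) * c i ^+ m.

Lemma power_comb_ext n (c c' f f' : 'I_n -> C) :
  c =1 c' -> f =1 f' -> power_comb c f -> power_comb c' f'.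
Proof.
move=> cc' ff' [a fE]; exists a => i; rewrite -ff' fE.
by apply: eq_bigr => m _; rewrite cc'.
Qed.

Lemma power_comb_expn n (c : 'I_n -> C) (m : 'I_n) :
  power_comb c (fun i => c i ^+ m).
Proof.
exists (fun k => (k == m)%:R) => i; rewrite (bigD1 m) //= eqxx rmorph1 mul1r.
by rewrite big1 ?addr0 // => k /negPf->; rewrite rmorph0 mul0r.
Qed.

Lemma power_combZ n (a : K0) (c f : 'I_n -> C) :
  power_comb c f -> power_comb c (fun i => phi a * f i).
Proof.
move=> [b fE]; exists (fun m => a * b m) => i; rewrite fE mulr_sumr.
by apply: eq_bigr => m _; rewrite rmorphM mulrA.
Qed.

Lemma power_comb0 n (c : 'I_n -> C) f : f =1 (fun=> 0) -> power_comb c f.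
Proof.
move=> f0; exists (fun=> 0) => i; rewrite f0 big1 // => m _.
by rewrite rmorph0 mul0r.
Qed.

Definition power_comb2 (n m : nat) (c : 'I_n -> C) (d : 'I_m -> C)
    (F : 'I_n -> 'I_m -> C) : Prop :=
  exists a : 'I_n -> 'I_m -> K0, forall i j,
    F i j = \sum_k \sum_l phi (a k l) * (c i ^+ k * d j ^+ l).

Lemma power_comb2_ext n m (c : 'I_n -> C) (d : 'I_m -> C) F F' :
  F =2 F' -> power_comb2 c d F -> power_comb2 c d F'.
Proof. by move=> FF' [a FE]; exists a => i j; rewrite -FF' FE. Qed.

Lemma power_comb2_0 n m (c : 'I_n -> C) (d : 'I_m -> C) F :
  F =2 (fun _ _ => 0) -> power_comb2 c d F.
Proof.
move=> F0; exists (fun _ _ => 0) => i j; rewrite F0 big1 // => k _.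
by rewrite big1 // => l _; rewrite rmorph0 mul0r.
Qed.

Lemma power_comb2Z n m (a : K0) (c : 'I_n -> C) (d : 'I_m -> C) F :
  power_comb2 c d F -> power_comb2 c d (fun i j => phi a * F i j).
Proof.
move=> [b FE]; exists (fun k l => a * b k l) => i j; rewrite FE mulr_sumr.
apply: eq_bigr => k _; rewrite mulr_sumr; apply: eq_bigr => l _.
by rewrite rmorphM mulrA.
Qed.

Lemma power_comb2M n m (c f : 'I_n -> C) (d g : 'I_m -> C) :
  power_comb c f -> power_comb d g ->
  power_comb2 c d (fun i j => f i * g j).
Proof.
move=> [a fE] [b gE]; exists (fun k l => a k * b l) => i j.
rewrite fE gE big_distrlr /=; apply: eq_bigr => k _; apply: eq_bigr => l _.
by rewrite rmorphM mulrACA.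
Qed.

Definition power_comb3 (n m o : nat) (c : 'I_n -> C) (d : 'I_m -> C)
    (e : 'I_o -> C) (F : 'I_n -> 'I_m -> 'I_o -> C) : Prop :=
  exists a : 'I_n -> 'I_m -> 'I_o -> K0, forall i j k,
    F i j k = \sum_u \sum_v \sum_w
                phi (a u v w) * (c i ^+ u * d j ^+ v * e k ^+ w).

Lemma power_comb3_ext n m o (c : 'I_n -> C) (d : 'I_m -> C) (e : 'I_o -> C)
    F F' :
  (forall i j k, F i j k = F' i j k) -> power_comb3 c d e F ->
  power_comb3 c d e F'.
Proof. by move=> FF' [a FE]; exists a => i j k; rewrite -FF' FE. Qed.

Lemma power_comb3_0 n m o (c : 'I_n -> C) (d : 'I_m -> C) (e : 'I_o -> C) F :
  (forall i j k, F i j k = 0) -> power_comb3 c d e F.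
Proof.
move=> F0; exists (fun _ _ _ => 0) => i j k; rewrite F0 big1 // => u _.
by rewrite big1 // => v _; rewrite big1 // => w _; rewrite rmorph0 mul0r.
Qed.

Lemma power_comb3M n m o (c f : 'I_n -> C) (d g : 'I_m -> C)
    (e h : 'I_o -> C) :
  power_comb c f -> power_comb d g -> power_comb e h ->
  power_comb3 c d e (fun i j k => f i * g j * h k).
Proof.
move=> [a fE] [b gE] [b' hE]; exists (fun u v w => a u * b v * b' w) => i j k.
rewrite fE gE hE big_distrlr /= mulr_suml; apply: eq_bigr => u _.
rewrite mulr_suml; apply: eq_bigr => v _.
rewrite mulr_sumr; apply: eq_bigr => w _.
by rewrite !rmorphM; ring.
Qed.

End PowerCombinations.

(** * Vandermonde matrices: interpolation at the conjugates and integral traces *)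

Section Vandermonde.

Variables (C : fieldType) (n : nat) (c : 'I_n -> C).
Hypothesis c_inj : injective c.

Let W : 'M[C]_n := Vandermonde n (\row_i c i).

Lemma Vandermonde_unit : W \in unitmx.
Proof.
rewrite unitmxE det_Vandermonde unitfE.
apply/prodf_neq0 => i _; apply/prodf_neq0 => j ij; rewrite !mxE subr_eq0.
by apply: contraTneq ij => /c_inj->; rewrite ltnn.
Qed.

(** Row [i0] of the inverse Vandermonde matrix holds the coefficients of the Lagrange polynomial
    that is 1 at [c i0] and 0 at the other nodes. *)
Lemma power_comb_delta (i0 : 'I_n) :
  power_comb (idfun : {rmorphism C -> C}) c (fun i => (i == i0)%:R).
Proof.
exists (fun m => invmx W i0 m) => i /=.
have /matrixP/(_ i0 i) := mulVmx Vandermonde_unit; rewrite !mxE eq_sym => <-.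
by apply: eq_bigr => m _; rewrite !mxE.
Qed.

(* Multiplication by f in the basis of powers of c has an integer matrix, and
   conjugating by the Vandermonde matrix makes it diagonal. *)
Lemma trace_int (f : 'I_n -> C) :
  (forall m : 'I_n, power_comb (intr : {rmorphism int -> C}) c
                      (fun i => f i * c i ^+ m)) ->
  exists t : int, \sum_i f i = t%:~R.
Proof.
move=> /fin_all_exists[a fE].
pose M : 'M[int]_n := \matrix_(m, k) a m k.
pose D : 'M[C]_n := diag_mx (\row_i f i).
have WD : W *m D = map_mx intr M *m W.
  apply/matrixP => m i; rewrite mul_mx_diag !mxE mulrC fE.
  by apply: eq_bigr => k _; rewrite !mxE.
exists (\tr M); have -> : \sum_i f i = \tr D.
  by rewrite mxtrace_diag; apply: eq_bigr => i _; rewrite mxE.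
rewrite -[D]mul1mx -(mulVmx Vandermonde_unit) -mulmxA WD mxtrace_mulC -mulmxA.
by rewrite mulmxV ?Vandermonde_unit // mulmx1 trace_map_mx.
Qed.

End Vandermonde.

Lemma monic_size_le1 (K : nzRingType) (Q : {poly K}) :
  Q \is monic -> (size Q <= 1)%N -> Q = 1.
Proof.
move=> Qmon /size1_polyC QE.
by move/monicP: Qmon; rewrite QE lead_coefC => ->.
Qed.

(** * Algebraic units: integral minimal polynomials and powers of conjugates *)

Section Units.

Variable C : numClosedFieldType.
Implicit Types (x z : C) (F : {poly int}).

Local Notation toC := (map_poly (intr : int -> C)).

Lemma map_ratr_int F : map_poly (ratr : rat -> C) (map_poly intr F) = (toC F).
Proof.
by rewrite -map_poly_comp; apply: eq_map_poly => k /=; rewrite ratr_int.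
Qed.

Lemma conjugate_root x z F :
  conjugate_over_Q x z -> root (toC F) x -> root (toC F) z.
Proof.
case=> P [[_ Pmin] Pz]; rewrite -map_ratr_int Pmin => /dvdpP[S ->].
by rewrite rmorphM rootM Pz orbT.
Qed.

(** A minimal polynomial of degree 0 would be 1, which has no root. Positivity of the three degrees
    is needed for the type of the algebra. *)
Lemma degree_over_Q_gt0 x n : degree_over_Q x n -> (0 < n)%N.
Proof.
case=> P [[Pmon Pmin] sP]; rewrite lt0n; apply/eqP => n0.
have P1 : P = 1 by apply: monic_size_le1; rewrite ?sP ?n0.
by have := Pmin 1; rewrite P1 dvdpp rmorph1 (negPf (root1 _)).
Qed.

(** Gauss's lemma: the minimal polynomial divides a monic integer polynomial over the rationals, so
    a rational multiple of it divides that polynomial over the integers. *)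
Lemma integral_minpoly x n :
  integralOver (intr : int -> C) x -> degree_over_Q x n ->
  exists P : {poly int}, [/\ P \is monic, size P = n.+1 & root (toC P) x].
Proof.
move=> [Q Qmon Qx] [P [[Pmon Pmin] sP]].
have : P %| map_poly intr Q by rewrite -Pmin map_ratr_int.
case/dvdpP_rat_int => P1 [a a0 PE] [S QE].
have sP1 : size P1 = n.+1.
  by rewrite -sP PE size_scale // size_map_inj_poly //; apply: intr_inj.
have P1x : root (toC P1) x.
  have : root (map_poly ratr P) x by rewrite Pmin dvdpp.
  by rewrite PE map_polyZ map_ratr_int rootZ // fmorph_eq0.
have lc : lead_coef P1 * lead_coef S = 1.
  by rewrite -lead_coefM -QE; apply/monicP.
(* The leading coefficients of [P1] and [S] are mutually inverse integers, so this rescaling makes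
   [P1] monic. *)
exists (lead_coef S *: P1); split.
- by rewrite monicE lead_coefZ mulrC lc.
- by rewrite size_scale //; apply: contra_eq_neq lc => ->; rewrite mulr0.
- by rewrite map_polyZ /= /root hornerZ (rootP P1x) mulr0.
Qed.

(** If [Q] is monic of degree d+1 and vanishes at x^-1, multiplying Q(x^-1) = 0 by x^d isolates x^-1
    and leaves only nonnegative powers of x. *)
Lemma integral_inv x : x != 0 -> integralOver (intr : int -> C) x^-1 ->
  exists G : {poly int}, x^-1 = (toC G).[x].
Proof.
move=> x0 [Q Qmon Qx].
have Q0 : Q != 0 by apply: monic_neq0.
have sQ : (1 < size Q)%N.
  rewrite ltnNge; apply: contraL Qx => sQ.
  rewrite (monic_size_le1 Qmon sQ).
  by rewrite rmorph1 (negPf (root1 _)).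
have [d sQE] : exists d, size Q = d.+2.
  by case: (size Q) sQ => [|[|d]] // _; exists d.
exists (- \sum_(i < d.+1) Q`_i *: 'X^(d - i)).
have := rootP Qx; rewrite horner_coef size_map_inj_poly //; last exact: intr_inj.
rewrite sQE big_ord_recr /= => /eqP; rewrite addrC addr_eq0 => /eqP.
rewrite coef_map /=.
have -> : Q`_d.+1 = 1 by move/monicP: Qmon; rewrite lead_coefE sQE.
rewrite mul1r => E.
have -> : x^-1 = x ^+ d * x^-1 ^+ d.+1.
  by rewrite exprS mulrCA -exprMn divff // expr1n mulr1.
rewrite E mulrN rmorphN /= hornerN; congr (- _).
rewrite rmorph_sum horner_sum mulr_sumr; apply: eq_bigr => i _.
rewrite coef_map /= map_polyZ map_polyXn hornerZ hornerXn mulrCA; congr (_ * _).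
have id : (i <= d)%N by rewrite -ltnS.
by rewrite -{1}(subnK id) exprD -mulrA -exprMn divff // expr1n mulr1.
Qed.

Lemma conjugates_root x n (c : 'I_n -> C) F i :
  conjugates x c -> root (toC F) x -> root (toC F) (c i).
Proof. by case=> _ cP; apply: conjugate_root; apply/cP; exists i. Qed.

Definition unit_conjugates (n : nat) (c : 'I_n -> C) : Prop :=
  exists x, [/\ algebraic_unit x, degree_over_Q x n & conjugates x c].

Section UnitConjugates.

Variables (n : nat) (c : 'I_n -> C).
Hypothesis c_unit : unit_conjugates c.

Lemma unit_conjugates_inj : injective c.
Proof. by have [x [_ _ []]] := c_unit. Qed.

Lemma unit_conjugates_gt0 : (0 < n)%N.
Proof. by have [x [_ /degree_over_Q_gt0]] := c_unit. Qed.

(** The polynomial X G - 1 vanishes at the unit, hence at all its conjugates; this is why one [G]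
    inverts all of them. *)
Lemma unit_conjugates_inv :
  exists G : {poly int}, forall i, c i * (toC G).[c i] = 1.
Proof.
have [x [[x0 _ xVint] _ c_conj]] := c_unit.
have [G GE] := integral_inv x0 xVint.
exists G => i; apply/eqP; rewrite -subr_eq0.
have H y : y * (toC G).[y] - 1 = (toC ('X * G - 1)).[y].
  by rewrite rmorphB rmorphM rmorph1 /= map_polyX !hornerE.
rewrite H; apply: conjugates_root c_conj _.
by rewrite /root -H -GE divff // subrr.
Qed.

Lemma unit_conjugates_neq0 i : c i != 0.
Proof.
have [G /(_ i) GE] := unit_conjugates_inv.
by apply: contra_eq_neq GE => ->; rewrite mul0r eq_sym oner_eq0.
Qed.

(** Euclidean division by the monic integral polynomial of degree [n] that vanishes at every
    conjugate: the remainder takes the same values and supplies the integer coefficients. *)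
Lemma power_comb_horner F :
  power_comb (intr : {rmorphism int -> C}) c (fun i => (toC F).[c i]).
Proof.
have [x [[_ xint _] x_deg c_conj]] := c_unit.
have [P [Pmon sP Px]] := integral_minpoly xint x_deg.
exists (fun m => (Pdiv.Ring.rmodp F P)`_m) => i.
rewrite {1}(Pdiv.RingMonic.rdivp_eq Pmon F) rmorphD rmorphM /= hornerD hornerM.
rewrite (rootP (conjugates_root i c_conj Px)) mulr0 add0r.
rewrite (@horner_coef_wide _ n); first by apply: eq_bigr => m _; rewrite coef_map.
rewrite size_map_inj_poly //; last exact: intr_inj.
by rewrite -ltnS -sP Pdiv.Ring.ltn_rmodpN0 ?monic_neq0.
Qed.

Lemma power_comb_exp (m : int) :
  power_comb (intr : {rmorphism int -> C}) c (fun i => c i ^ m).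
Proof.
have [G GE] := unit_conjugates_inv.
have GV i : (toC G).[c i] = (c i)^-1.
  by apply: (mulfI (unit_conjugates_neq0 i)); rewrite GE divff ?unit_conjugates_neq0.
case: m => m.
  apply: power_comb_ext (power_comb_horner 'X^m) => // i.
  by rewrite map_polyXn hornerXn.
(* The negative constructor of [int] at [m] stands for -(m+1), hence the shifted exponent. *)
apply: power_comb_ext (power_comb_horner (G ^+ m.+1)) => // i.
by rewrite rmorphXn /= horner_exp GV exprVn.
Qed.

(** The script vectors of the [Y] and [Z] families use powers of inverses. Expanding c^(m+n-1) in
    the powers c^0, ..., c^(n-1) and dividing by c^(n-1) turns c^k into the inverse power of
    exponent n-1-k, so the coefficients are read in reverse order. *)
Lemma power_comb_inv_exp (m : int) :
  power_comb (intr : {rmorphism int -> C}) (fun i => (c i)^-1)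
    (fun i => c i ^ m).
Proof.
have [a aE] := power_comb_exp (m + n.-1%:Z).
exists (fun k => a (rev_ord k)) => i; have ci0 := unit_conjugates_neq0 i.
have -> : c i ^ m = c i ^ (m + n.-1%:Z) * (c i)^-1 ^+ n.-1.
  by rewrite expfzDr // -mulrA -exprnP -exprMn divff // expr1n mulr1.
rewrite aE mulr_suml (reindex_inj rev_ord_inj); apply: eq_bigr => k _ /=.
rewrite -mulrA; congr (_ * _).
have kn : (k <= n.-1)%N by rewrite -ltnS prednK //; case: n k => [[]|].
have -> : (n - k.+1 = n.-1 - k)%N by rewrite -subn1 -subnDA add1n.
by rewrite -{2}(subnK kn) exprD mulrA -exprMn divff // expr1n mul1r.
Qed.

Lemma trace_exp_int (m : int) : exists t : int, \sum_i c i ^ m = t%:~R.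
Proof.
apply: trace_int unit_conjugates_inj _ _ => k.
apply: power_comb_ext (power_comb_exp (m + k%:Z)) => // i.
by rewrite expfzDr ?unit_conjugates_neq0.
Qed.

End UnitConjugates.

End Units.

(** Pigeonhole: each condition excludes at most one exponent, so one of the exponents 1, ..., #|I|+1
    is allowed. *)
Lemma avoid_finitely_many (I : finType) (bad : I -> nat -> bool) :
  (forall i m n, bad i m -> bad i n -> m = n) ->
  exists n, (0 < n)%N /\ forall i, ~~ bad i n.
Proof.
move=> bad1.
have [/existsP[n /forallP nP]|] :=
  boolP [exists n : 'I_#|I|.+1, [forall i, ~~ bad i n.+1]].
  by exists n.+1.
rewrite negb_exists => /forallP H.
(* Otherwise choosing a violated condition for each exponent would inject #|I|+1 elements into
   [I]. *)
have /fin_all_exists[f fP] (n : 'I_#|I|.+1) : exists i, bad i n.+1.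
  by have /forallPn[i /negbNE] := H n; exists i.
have f_inj : injective f.
  move=> m n fmn; apply: ord_inj; apply: succn_inj.
  by apply: bad1 (fP m) _; rewrite fmn.
by have := leq_card f f_inj; rewrite card_ord ltnn.
Qed.

(** * The bracket in coordinates *)

(** The monoid law is kept generic so that the splitting applies to sums of vectors, of scalars and
    of cardinalities. *)
Lemma big_beta (T : Type) (idx : T) (op : Monoid.com_law idx)
    (p q r : nat) (F : beta p q r -> T) :
  \big[op/idx]_a F a =
  op (op (op (op (op
    (\big[op/idx]_i \big[op/idx]_j \big[op/idx]_k F (BX i j k))
    (\big[op/idx]_j F (BY j)))
    (\big[op/idx]_k F (BZ k)))
    (\big[op/idx]_i \big[op/idx]_k F (BV i k)))
    (\big[op/idx]_i \big[op/idx]_j F (BW i j)))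
    (\big[op/idx]_i F (BU i)).
Proof.
rewrite (reindex (@beta_decode p q r)) /=; last first.
  apply: onW_bij; exists (@beta_encode p q r); last exact: beta_encodeK.
  by case=> [[[[[[[i j] k]|j]|k]|[i k]]|[i j]]|i].
rewrite !big_sumType /=.
have pairE (I J : finType) (G : I * J -> T) :
    \big[op/idx]_u G u = \big[op/idx]_i \big[op/idx]_j G (i, j).
  by rewrite pair_bigA; apply: eq_bigr => -[].
by rewrite !pairE.
Qed.

(** * Sums supported on a single family of the basis *)

Section BlockSums.

Variables (T : nmodType) (p q r : nat) (F : beta p q r -> T).

Let zX : (forall i j k, F (BX i j k) = 0) ->
  \sum_i \sum_j \sum_k F (BX i j k) = 0.
Proof.
move=> F0; apply: big1 => i _; apply: big1 => j _; apply: big1 => k _; exact: F0.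
Qed.

Let zY : (forall j, F (BY j) = 0) ->
  \sum_j F (BY j) = 0.
Proof.
move=> F0; apply: big1 => j _; exact: F0.
Qed.

Let zZ : (forall k, F (BZ k) = 0) ->
  \sum_k F (BZ k) = 0.
Proof.
move=> F0; apply: big1 => k _; exact: F0.
Qed.

Let zV : (forall i k, F (BV i k) = 0) ->
  \sum_i \sum_k F (BV i k) = 0.
Proof.
move=> F0; apply: big1 => i _; apply: big1 => k _; exact: F0.
Qed.

Let zW : (forall i j, F (BW i j) = 0) ->
  \sum_i \sum_j F (BW i j) = 0.
Proof.
move=> F0; apply: big1 => i _; apply: big1 => j _; exact: F0.
Qed.

Let zU : (forall i, F (BU i) = 0) ->
  \sum_i F (BU i) = 0.
Proof.
move=> F0; apply: big1 => i _; exact: F0.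
Qed.

(** The support condition is boolean so that a case analysis on [b] settles the surviving family by
    computation. *)
Lemma big_betaX :
  (forall b, (if b is BX _ _ _ then true else false) || (F b == 0)) ->
  \sum_a F a = \sum_i \sum_j \sum_k F (BX i j k).
Proof.
move=> F0; rewrite big_beta /=.
rewrite (zY (fun j => eqP (F0 (BY j)))).
rewrite (zZ (fun k => eqP (F0 (BZ k)))).
rewrite (zV (fun i k => eqP (F0 (BV i k)))).
rewrite (zW (fun i j => eqP (F0 (BW i j)))).
rewrite (zU (fun i => eqP (F0 (BU i)))).
by rewrite ?add0r ?addr0.
Qed.

Lemma big_betaY :
  (forall b, (if b is BY _ then true else false) || (F b == 0)) ->
  \sum_a F a = \sum_j F (BY j).
Proof.
move=> F0; rewrite big_beta /=.
rewrite (zX (fun i j k => eqP (F0 (BX i j k)))).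
rewrite (zZ (fun k => eqP (F0 (BZ k)))).
rewrite (zV (fun i k => eqP (F0 (BV i k)))).
rewrite (zW (fun i j => eqP (F0 (BW i j)))).
rewrite (zU (fun i => eqP (F0 (BU i)))).
by rewrite ?add0r ?addr0.
Qed.

Lemma big_betaZ :
  (forall b, (if b is BZ _ then true else false) || (F b == 0)) ->
  \sum_a F a = \sum_k F (BZ k).
Proof.
move=> F0; rewrite big_beta /=.
rewrite (zX (fun i j k => eqP (F0 (BX i j k)))).
rewrite (zY (fun j => eqP (F0 (BY j)))).
rewrite (zV (fun i k => eqP (F0 (BV i k)))).
rewrite (zW (fun i j => eqP (F0 (BW i j)))).
rewrite (zU (fun i => eqP (F0 (BU i)))).
by rewrite ?add0r ?addr0.
Qed.

Lemma big_betaV :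
  (forall b, (if b is BV _ _ then true else false) || (F b == 0)) ->
  \sum_a F a = \sum_i \sum_k F (BV i k).
Proof.
move=> F0; rewrite big_beta /=.
rewrite (zX (fun i j k => eqP (F0 (BX i j k)))).
rewrite (zY (fun j => eqP (F0 (BY j)))).
rewrite (zZ (fun k => eqP (F0 (BZ k)))).
rewrite (zW (fun i j => eqP (F0 (BW i j)))).
rewrite (zU (fun i => eqP (F0 (BU i)))).
by rewrite ?add0r ?addr0.
Qed.

Lemma big_betaW :
  (forall b, (if b is BW _ _ then true else false) || (F b == 0)) ->
  \sum_a F a = \sum_i \sum_j F (BW i j).
Proof.
move=> F0; rewrite big_beta /=.
rewrite (zX (fun i j k => eqP (F0 (BX i j k)))).
rewrite (zY (fun j => eqP (F0 (BY j)))).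
rewrite (zZ (fun k => eqP (F0 (BZ k)))).
rewrite (zV (fun i k => eqP (F0 (BV i k)))).
rewrite (zU (fun i => eqP (F0 (BU i)))).
by rewrite ?add0r ?addr0.
Qed.

Lemma big_betaU :
  (forall b, (if b is BU _ then true else false) || (F b == 0)) ->
  \sum_a F a = \sum_i F (BU i).
Proof.
move=> F0; rewrite big_beta /=.
rewrite (zX (fun i j k => eqP (F0 (BX i j k)))).
rewrite (zY (fun j => eqP (F0 (BY j)))).
rewrite (zZ (fun k => eqP (F0 (BZ k)))).
rewrite (zV (fun i k => eqP (F0 (BV i k)))).
rewrite (zW (fun i j => eqP (F0 (BW i j)))).
by rewrite ?add0r ?addr0.
Qed.

End BlockSums.

Section Bracket.

Variables (K : fieldType) (p q r : nat).

Local Notation vec := (nspace K p q r).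
Implicit Types (x y z : vec).

Lemma sum_delta (I : finType) (F : I -> K) (i0 : I) :
  \sum_i F i * (i == i0)%:R = F i0.
Proof.
rewrite (bigD1 i0) //= eqxx mulr1 big1 ?addr0 // => i /negPf->.
by rewrite mulr0.
Qed.

(* The codomain K^o of the vectors carries its own tower of structures;
   reading coordinates in K itself keeps the algebra in one structure. *)
Definition crd x (b : beta p q r) : K := x b.

Lemma crdP x y : (forall b, crd x b = crd y b) -> x = y.
Proof. by move=> xy; apply/ffunP. Qed.

Lemma crd0 b : crd 0 b = 0.
Proof. by rewrite /crd ffunE. Qed.

Lemma crdD x y b : crd (x + y) b = crd x b + crd y b.
Proof. by rewrite /crd ffunE. Qed.

Lemma crdN x b : crd (- x) b = - crd x b.
Proof. by rewrite /crd ffunE. Qed.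

Lemma crdZ (c : K) x b : crd (c *: x) b = c * crd x b.
Proof. by rewrite /crd ffunE. Qed.

Lemma crd_sum (I : Type) (s : seq I) (P : pred I) (F : I -> vec) b :
  crd (\sum_(i <- s | P i) F i) b = \sum_(i <- s | P i) crd (F i) b.
Proof.
by apply: (big_morph (fun x => crd x b)) => [x y|]; rewrite (crdD, crd0).
Qed.

Lemma crd_bvec (a b : beta p q r) : crd (bvec K a) b = (b == a)%:R.
Proof. by rewrite /crd ffunE. Qed.

Lemma sum_scale0 (I : finType) (F : I -> K) : \sum_i F i *: (0 : vec) = 0.
Proof. by rewrite big1 // => i _; rewrite scaler0. Qed.

Lemma sum_scale00 (I J : finType) (F : I -> J -> K) :
  \sum_i \sum_j F i j *: (0 : vec) = 0.
Proof. by rewrite big1 // => i _; apply: sum_scale0. Qed.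

Lemma sum_scale000 (I J L : finType) (F : I -> J -> L -> K) :
  \sum_i \sum_j \sum_k F i j k *: (0 : vec) = 0.
Proof. by rewrite big1 // => i _; apply: sum_scale00. Qed.

Lemma eq_BV i k i' k' : (BV i k == BV i' k' :> beta p q r) = (i == i') && (k == k').
Proof. by []. Qed.

Lemma eq_BW i j i' j' : (BW i j == BW i' j' :> beta p q r) = (i == i') && (j == j').
Proof. by []. Qed.

Lemma eq_BU i i' : (BU i == BU i' :> beta p q r) = (i == i').
Proof. by []. Qed.

Lemma sum_half_bracket (a : beta p q r) y :
  \sum_b crd y b *: half_bracket K a b =
  match a with
  | BX i j k => crd y (BY j) *: bvec K (BV i k) + crd y (BZ k) *: bvec K (BW i j)
  | BY j => \sum_i crd y (BW i j) *: bvec K (BU i)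
  | BZ k => \sum_i crd y (BV i k) *: bvec K (BU i)
  | _ => 0
  end.
Proof.
have pick (I : finType) (F : I -> K) (i0 : I) (v : vec) :
    \sum_i F i *: ((i0 == i)%:R *: v) = F i0 *: v.
  rewrite -(sum_delta F) scaler_suml; apply: eq_bigr => i _.
  by rewrite scalerA eq_sym.
rewrite big_beta; case: a => [i j k|j|k|i k|i j|i] /=;
  rewrite ?sum_scale000 ?sum_scale00 ?sum_scale0 ?add0r ?addr0 ?pick //.
  by apply: eq_bigr => i _; rewrite pick.
by apply: eq_bigr => i _; rewrite pick.
Qed.

Definition half_coord x y (b : beta p q r) : K :=
  match b with
  | BV i k => \sum_j crd x (BX i j k) * crd y (BY j)
  | BW i j => \sum_k crd x (BX i j k) * crd y (BZ k)
  | BU i => \sum_k crd x (BZ k) * crd y (BV i k) + \sum_j crd x (BY j) * crd y (BW i j)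
  | _ => 0
  end.

(** The two halves of the skew-symmetrized table are kept apart because integrality of the bracket
    on script vectors is proved for each half separately. *)
Lemma nbracket_half x y b :
  crd (nbracket x y) b = half_coord x y b - half_coord y x b.
Proof.
have halfE u v :
    crd (\sum_a crd u a *: \sum_c crd v c *: half_bracket K a c) b
    = half_coord u v b.
  under eq_bigr => a _ do rewrite sum_half_bracket.
  rewrite big_beta /= sum_scale00 sum_scale00 sum_scale0 !addr0 !crdD.
  rewrite !crd_sum.
  under eq_bigr => i _ do (rewrite crd_sum; under eq_bigr => j _ do
    (rewrite crd_sum; under eq_bigr => k _ do
       rewrite crdZ crdD !crdZ !crd_bvec)).
  under [X in _ + X + _]eq_bigr => j _ do (rewrite crdZ crd_sum;
    under eq_bigr => i _ do rewrite crdZ crd_bvec).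
  under [X in _ + _ + X]eq_bigr => j _ do (rewrite crdZ crd_sum;
    under eq_bigr => i _ do rewrite crdZ crd_bvec).
  have z3 (F : 'I_p -> 'I_q -> 'I_r -> K) (G : 'I_q -> K) (H : 'I_r -> K) :
      \sum_i \sum_j \sum_k F i j k * (G j * 0 + H k * 0) = 0.
    apply: big1 => i _; apply: big1 => j _; apply: big1 => k _.
    by rewrite !mulr0 addr0 mulr0.
  have z2 (I J : finType) (F : J -> K) (G : J -> I -> K) :
      \sum_j F j * (\sum_i G j i * 0) = 0.
    apply: big1 => i _; rewrite big1 ?mulr0 // => j _; exact: mulr0.
  case: b => [i j k|j|k|i k|i j|i] /=; rewrite ?z3 ?z2 ?addr0 ?add0r //.
  - under eq_bigr => i0 _ do under eq_bigr => j _ do (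
      under eq_bigr => k0 _ do
        rewrite mulr0 addr0 eq_BV -mulnb natrM (eq_sym i i0) (eq_sym k k0) !mulrA;
      rewrite sum_delta).
    by rewrite exchange_big; apply: eq_bigr => j _; rewrite sum_delta.
  - under eq_bigr => i0 _ do under eq_bigr => j0 _ do
      under eq_bigr => k _ do
        rewrite mulr0 add0r eq_BW -mulnb natrM (eq_sym i) (eq_sym j) !mulrA.
    under eq_bigr => i0 _ do rewrite exchange_big.
    rewrite exchange_big; apply: eq_bigr => k _.
    under eq_bigr => i0 _ do rewrite sum_delta.
    by rewrite sum_delta.
  - rewrite addrC; congr (_ + _); apply: eq_bigr => j _.
      by under eq_bigr => i0 _ do rewrite eq_BU eq_sym; rewrite sum_delta.
    by under eq_bigr => i0 _ do rewrite eq_BU eq_sym; rewrite sum_delta.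
(* Exchanging the two summation indices in the subtracted half turns it into the first half with [x]
   and [y] swapped. *)
have -> : nbracket x y =
    \sum_a crd x a *: (\sum_c crd y c *: half_bracket K a c)
    - \sum_a crd y a *: (\sum_c crd x c *: half_bracket K a c).
  transitivity (\sum_a \sum_c ((crd x a * crd y c) *: half_bracket K a c
                               - (crd x a * crd y c) *: half_bracket K c a)).
    by apply: eq_bigr => a _; apply: eq_bigr => c _; rewrite -scalerBr.
  under eq_bigr => a _ do rewrite sumrB.
  rewrite sumrB [X in _ - X]exchange_big; congr (_ - _).
    apply: eq_bigr => a _; rewrite scaler_sumr.
    by apply: eq_bigr => c _; rewrite scalerA.
  apply: eq_bigr => a _; rewrite scaler_sumr.
  by apply: eq_bigr => c _; rewrite scalerA mulrC.
by rewrite crdD crdN !halfE.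
Qed.

Lemma nbracketE x y b :
  crd (nbracket x y) b =
  match b with
  | BV i k => \sum_j (crd x (BX i j k) * crd y (BY j)
                    - crd y (BX i j k) * crd x (BY j))
  | BW i j => \sum_k (crd x (BX i j k) * crd y (BZ k)
                    - crd y (BX i j k) * crd x (BZ k))
  | BU i => \sum_k (crd x (BZ k) * crd y (BV i k) - crd y (BZ k) * crd x (BV i k))
          + \sum_j (crd x (BY j) * crd y (BW i j) - crd y (BY j) * crd x (BW i j))
  | _ => 0
  end.
Proof.
rewrite nbracket_half; case: b => [i j k|j|k|i k|i j|i] /=;
  rewrite ?subr0 ?sumrB //.
by rewrite opprD addrACA.
Qed.

Lemma nbracketX x y i j k : crd (nbracket x y) (BX i j k) = 0.
Proof. by rewrite nbracketE. Qed.

Lemma nbracketY x y j : crd (nbracket x y) (BY j) = 0.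
Proof. by rewrite nbracketE. Qed.

Lemma nbracketZ x y k : crd (nbracket x y) (BZ k) = 0.
Proof. by rewrite nbracketE. Qed.

Lemma nbracketV x y i k : crd (nbracket x y) (BV i k) =
  \sum_j (crd x (BX i j k) * crd y (BY j) - crd y (BX i j k) * crd x (BY j)).
Proof. by rewrite nbracketE. Qed.

Lemma nbracketW x y i j : crd (nbracket x y) (BW i j) =
  \sum_k (crd x (BX i j k) * crd y (BZ k) - crd y (BX i j k) * crd x (BZ k)).
Proof. by rewrite nbracketE. Qed.

Lemma nbracket_linearl y : linear (nbracket^~ y : vec -> vec).
Proof.
move=> c u v; apply: crdP => b; rewrite crdD crdZ !nbracketE.
case: b => [i j k|j|k|i k|i j|i]; rewrite ?mulr0 ?addr0 //.
- rewrite mulr_sumr -big_split; apply: eq_bigr => m _ /=.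
  by rewrite !crdD !crdZ; ring.
- rewrite mulr_sumr -big_split; apply: eq_bigr => m _ /=.
  by rewrite !crdD !crdZ; ring.
rewrite mulrDr !mulr_sumr addrACA -!big_split.
congr (_ + _); apply: eq_bigr => m _ /=; by rewrite !crdD !crdZ; ring.
Qed.

Lemma nbracketC x y : nbracket x y = - nbracket y x.
Proof.
apply: crdP => b; rewrite crdN !nbracketE.
case: b => [i j k|j|k|i k|i j|i]; rewrite ?oppr0 ?opprD -?sumrN //.
- by apply: eq_bigr => m _; rewrite opprB.
- by apply: eq_bigr => m _; rewrite opprB.
by congr (_ + _); apply: eq_bigr => m _; rewrite opprB.
Qed.

(** A bracket has no [BX], [BY] or [BZ] coordinate, so a double bracket can only have [BU]
    coordinates. *)
Lemma nbracket_jacobi x y z :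
  nbracket x (nbracket y z) + nbracket y (nbracket z x)
    + nbracket z (nbracket x y) = 0.
Proof.
apply: crdP => b; rewrite !crdD crd0 !(nbracketE _ (nbracket _ _)).
case: b => [i j k|j|k|i k|i j|i]; rewrite ?addr0 //.
- rewrite -!big_split big1 // => m _.
  by rewrite !(nbracketX, nbracketY, nbracketZ) /=; ring.
- rewrite -!big_split big1 // => m _.
  by rewrite !(nbracketX, nbracketY, nbracketZ) /=; ring.
(* Both parts of the [BU] coordinate become one double sum of trilinear terms in the [BX], [BY],
   [BZ] coordinates; the cyclic sum then cancels for each j and k. *)
have expand u v w :
    \sum_k (crd u (BZ k) * crd (nbracket v w) (BV i k)
           - crd (nbracket v w) (BZ k) * crd u (BV i k)) +
    \sum_j (crd u (BY j) * crd (nbracket v w) (BW i j)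
           - crd (nbracket v w) (BY j) * crd u (BW i j)) =
    \sum_j \sum_k
      (crd u (BZ k) * (crd v (BX i j k) * crd w (BY j)
                     - crd w (BX i j k) * crd v (BY j))
     + crd u (BY j) * (crd v (BX i j k) * crd w (BZ k)
                     - crd w (BX i j k) * crd v (BZ k))).
  under eq_bigr => k _ do rewrite nbracketZ nbracketV mul0r subr0 mulr_sumr.
  rewrite exchange_big -big_split; apply: eq_bigr => j _.
  by rewrite nbracketY nbracketW mul0r subr0 mulr_sumr -big_split.
rewrite !expand -!big_split big1 // => j _.
by rewrite -!big_split big1 // => k _ /=; ring.
Qed.

Lemma nbracket_lie : lie_bracket (nbracket : vec -> vec -> vec).
Proof.
split; [exact: nbracket_linearl| | |exact: nbracket_jacobi].
- move=> x c u v; rewrite nbracketC nbracket_linearl opprD -scalerN.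
  by rewrite -!nbracketC.
(* Antisymmetry does not give this in characteristic two, so the coordinates are computed
   directly. *)
- move=> x; apply: crdP => b; rewrite nbracketE crd0.
  case: b => [i j k|j|k|i k|i j|i] //; rewrite ?big1 ?addr0 // => m _;
    by rewrite subrr.
Qed.

End Bracket.

(** * The lower central series *)

Section BracketSpace.

Variables (K : fieldType) (V : vectType K) (br : V -> V -> V).
Hypothesis br_lie : lie_bracket br.

Lemma linear_lincomb (f : V -> V) (I : Type) (s : seq I) (a : I -> K)
    (v : I -> V) :
  linear f -> f (\sum_(i <- s) a i *: v i) = \sum_(i <- s) a i *: f (v i).
Proof.
move=> f_lin; elim: s => [|i s IHs]; last by rewrite !big_cons f_lin IHs.
by have := f_lin (-1) 0 0; rewrite !big_nil scaler0 addr0 scaleN1r addNr.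
Qed.

Lemma brv_mem (U W : {vspace V}) u w :
  u \in U -> w \in W -> br u w \in brv br U W.
Proof.
have [linl linr _ _] := br_lie.
move=> /coord_vbasis-> /coord_vbasis->.
rewrite (linear_lincomb _ _ _ (linl _)); apply: memv_suml => i _.
rewrite memvZ // (linear_lincomb _ _ _ (linr _)); apply: memv_suml => j _.
by rewrite memvZ // memv_span // allpairs_f // mem_nth ?size_tuple.
Qed.

Lemma brv_subv (U W S : {vspace V}) :
  (forall u w, u \in U -> w \in W -> br u w \in S) -> (brv br U W <= S)%VS.
Proof.
move=> brS; apply/span_subvP => _ /allpairsP[[u w] /= [uU wW ->]].
by apply: brS; apply: vbasis_mem.
Qed.

End BracketSpace.

Section LowerCentralSeries.

Variables (K : fieldType) (p q r : nat).

Local Notation vec := (nspace K p q r).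
Implicit Types (x y z : vec) (P : pred (beta p q r)).

Lemma crd_lincomb (F : beta p q r -> K) b :
  crd (\sum_a F a *: bvec K a) b = F b.
Proof.
rewrite crd_sum -[RHS]sum_delta; apply: eq_bigr => a _.
by rewrite crdZ crd_bvec eq_sym.
Qed.

Lemma crd_decomp x : x = \sum_a crd x a *: bvec K a.
Proof. by apply: crdP => b; rewrite crd_lincomb. Qed.

(** The terms of the lower central series are such coordinate subspaces, which reduces their
    dimensions to counting basis vectors. *)
Definition crdspace P : {vspace vec} := <<[seq bvec K a | a in P]>>%VS.

Lemma crd_span0 (s : seq (beta p q r)) x b :
  x \in <<map (@bvec K p q r) s>>%VS -> b \notin s -> crd x b = 0.
Proof.
elim: s x => [|a s IHs] x.
  by rewrite span_nil memv0 => /eqP-> _; rewrite crd0.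
rewrite span_cons => /memv_addP[_ /vlineP[c ->] [y ys ->]].
rewrite inE => /norP[ba bs]; rewrite crdD crdZ crd_bvec (negPf ba) mulr0 add0r.
exact: IHs.
Qed.

Lemma free_bvec (s : seq (beta p q r)) :
  uniq s -> free (map (@bvec K p q r) s).
Proof.
elim: s => [|a s IHs] /=; first by rewrite nil_free.
case/andP=> a_s /IHs s_free; rewrite free_cons s_free andbT.
apply/negP => /crd_span0/(_ a_s)/eqP.
by rewrite crd_bvec eqxx oner_eq0.
Qed.

Lemma dim_crdspace P : \dim (crdspace P) = #|P|.
Proof. by rewrite (eqnP (free_bvec (enum_uniq P))) size_map cardE. Qed.

Lemma crdspaceP P x :
  reflect (forall b, ~~ P b -> crd x b = 0) (x \in crdspace P).
Proof.
apply: (iffP idP) => [xP b Pb | x0].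
  by apply: crd_span0 xP _; rewrite mem_enum.
rewrite [x]crd_decomp; apply: memv_suml => a _.
have [Pa|Pa] := boolP (P a); last by rewrite x0 // scale0r mem0v.
by rewrite memvZ // memv_span // map_f // mem_enum.
Qed.

Lemma crdspace_sub P (S : {vspace vec}) :
  (forall a, P a -> bvec K a \in S) -> (crdspace P <= S)%VS.
Proof.
move=> PS; apply/span_subvP => _ /mapP[a aP ->].
by apply: PS; move: aP; rewrite mem_enum.
Qed.

Lemma nbracket_bvec (a b : beta p q r) :
  nbracket (bvec K a) (bvec K b) = half_bracket K a b - half_bracket K b a.
Proof.
have crdE (c d : beta p q r) : bvec K c d = (d == c)%:R by rewrite ffunE.
rewrite /nbracket (bigD1 a) //= (bigD1 b) //= !crdE !eqxx mul1r scale1r.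
rewrite big1 => [|d /negPf db]; last by rewrite !crdE db mulr0 scale0r.
rewrite addr0 big1 ?addr0 // => c /negPf ca.
by rewrite big1 // => d _; rewrite !crdE ca mul0r scale0r.
Qed.

Definition in_lcs1 (a : beta p q r) : bool :=
  match a with BV _ _ | BW _ _ | BU _ => true | _ => false end.

Definition in_lcs2 (a : beta p q r) : bool :=
  if a is BU _ then true else false.

Lemma dim_lcs0 : \dim (fullv : {vspace vec})
  = (p * q * r + q + r + (p * r + p * q) + p)%N.
Proof.
have -> : fullv = crdspace predT.
  by apply/esym/vspaceP => x; rewrite memvf; apply/crdspaceP.
rewrite dim_crdspace -sum1_card big_beta /=.
by rewrite !sum_nat_const !card_ord; ring.
Qed.

Lemma dim_crdspace1 : \dim (crdspace in_lcs1) = (p * r + p * q + p)%N.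
Proof.
rewrite dim_crdspace -sum1_card big_mkcond big_beta /= /in_mem /=.
by rewrite !sum_nat_const !card_ord; ring.
Qed.

Lemma dim_crdspace2 : \dim (crdspace in_lcs2) = p.
Proof.
rewrite dim_crdspace -sum1_card big_mkcond big_beta /= /in_mem /=.
by rewrite !sum_nat_const !card_ord; ring.
Qed.

Hypotheses (p_gt0 : (0 < p)%N) (q_gt0 : (0 < q)%N) (r_gt0 : (0 < r)%N).

Local Notation br := (nbracket : vec -> vec -> vec).

Lemma lcs1E : lcs br 1 = crdspace in_lcs1.
Proof.
have lieb := nbracket_lie K p q r.
apply/eqP; rewrite eqEsubv; apply/andP; split.
  by apply: brv_subv => u w _ _; apply/crdspaceP => b; rewrite nbracketE; case: b.
(* Positivity of [q] and [r] provides the indices in V_(i,k) = [X_(i,j0,k), Y_j0], W_(i,j) =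
   [X_(i,j,k0), Z_k0] and U_i = [Y_j0, W_(i,j0)]. *)
pose j0 := Ordinal q_gt0; pose k0 := Ordinal r_gt0.
apply: crdspace_sub => a; case: a => // [i k|i j|i] _.
- have -> : bvec K (BV i k) = br (bvec K (BX i j0 k)) (bvec K (BY j0)).
    by rewrite nbracket_bvec /half_bracket eqxx scale1r subr0.
  by apply: brv_mem; rewrite ?memvf.
- have -> : bvec K (BW i j) = br (bvec K (BX i j k0)) (bvec K (BZ k0)).
    by rewrite nbracket_bvec /half_bracket eqxx scale1r subr0.
  by apply: brv_mem; rewrite ?memvf.
have -> : bvec K (BU i) = br (bvec K (BY j0)) (bvec K (BW i j0)).
  by rewrite nbracket_bvec /half_bracket eqxx scale1r subr0.
by apply: brv_mem; rewrite ?memvf.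
Qed.

(** The [BV] and [BW] coordinates of a bracket pair [BX] with [BY] or [BZ] coordinates, which vanish
    on the first term; each U_i is still reached, as the bracket of a Y with a W. *)
Lemma lcs2E : lcs br 2 = crdspace in_lcs2.
Proof.
have lieb := nbracket_lie K p q r.
rewrite /lcs iterS -/(lcs br 1) lcs1E.
apply/eqP; rewrite eqEsubv; apply/andP; split.
  apply: brv_subv => u w _ /crdspaceP w0; apply/crdspaceP => b.
  rewrite nbracketE; case: b => //= [i k|i j] _; apply: big1 => m _.
    by rewrite !w0 // mulr0 mul0r subrr.
  by rewrite !w0 // mulr0 mul0r subrr.
pose j0 := Ordinal q_gt0.
apply: crdspace_sub => a; case: a => // i _.
have -> : bvec K (BU i) = br (bvec K (BY j0)) (bvec K (BW i j0)).
  by rewrite nbracket_bvec /half_bracket eqxx scale1r subr0.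
apply: brv_mem; rewrite ?memvf //; apply/crdspaceP => b.
by case: b => //= *; rewrite crd_bvec.
Qed.

Lemma lcs3E : lcs br 3 = 0%VS.
Proof.
rewrite /lcs iterS -/(lcs br 2) lcs2E.
apply/eqP; rewrite -subv0.
apply: brv_subv => u w _ /crdspaceP w0; rewrite memv0; apply/eqP/crdP => b.
rewrite nbracketE crd0; case: b => //= *; rewrite ?big1 ?addr0 // => m _;
  by rewrite !w0 // mulr0 mul0r subrr.
Qed.

Lemma nspace_lie_type :
  lie_type br [:: (p * q * r + q + r)%N; (p * r + p * q)%N; p].
Proof.
split; last first.
  have dim0 : \dim (lcs br 0) = (p * q * r + q + r + (p * r + p * q) + p)%N.
    exact: dim_lcs0.
  transitivity [:: \dim (lcs br 0) - \dim (lcs br 1);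
                   \dim (lcs br 1) - \dim (lcs br 2);
                   \dim (lcs br 2) - \dim (lcs br 3)]%N; last by [].
  rewrite dim0 lcs1E lcs2E lcs3E dimv0 dim_crdspace1 dim_crdspace2 subn0.
  by rewrite addnK -(addnA (_ + _ + r)%N) addnK.
split=> //; first exact: lcs3E.
rewrite lcs2E => /(congr1 (fun U : {vspace vec} => \dim U)).
by rewrite dim_crdspace2 dimv0 => p0; move: p_gt0; rewrite p0.
Qed.

End LowerCentralSeries.

(** * Integral combinations of the script vectors *)

Section Combinations.

Variables (K0 : comNzRingType) (C : fieldType) (phi : {rmorphism K0 -> C}).
Variables (V : vectType C) (I : finType) (e : I -> V).

Definition comb_of (v : V) : Prop :=
  exists c : I -> K0, v = \sum_k phi (c k) *: e k.

Lemma comb_ofB u v : comb_of u -> comb_of v -> comb_of (u - v).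
Proof.
move=> [a ->] [b ->]; exists (fun k => a k - b k); rewrite -sumrB.
by apply: eq_bigr => k _; rewrite rmorphB scalerBl.
Qed.

End Combinations.

(** * Bases and invertible integer matrices *)

Section BasisMatrix.

Variables (C : fieldType) (V : vectType C) (I : finType) (e : I -> V).

Lemma free_coef0 (a : I -> C) :
  free [seq e i | i : I] -> \sum_i a i *: e i = 0 -> forall i, a i = 0.
Proof.
move=> e_free a0 i.
have /freeP/(_ (fun k => a (enum_val k))) : free [tuple of [seq e i | i : I]].
  by [].
rewrite -(enum_rankK i); apply.
rewrite -[RHS]a0 [RHS](big_enum_val (A := predT) (fun j => a j *: e j)).
by apply: eq_bigr => k _; rewrite nth_image.
Qed.

(** The family [e] spans a basis indexed by the same type, so it is a spanning family of the right
    cardinality. *)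
Lemma basis_of_comb (b : I -> V) :
  basis_of fullv [seq b i | i : I] ->
  (forall i, comb_of (idfun : {rmorphism C -> C}) e (b i)) ->
  basis_of fullv [seq e i | i : I].
Proof.
move=> b_basis be; rewrite basisEdim (size_basis b_basis) size_image leqnn.
rewrite andbT -(span_basis b_basis); apply/span_subvP => _ /imageP[i _ ->].
have [c ->] := be i; apply: memv_suml => k _.
by rewrite memvZ // memv_span // image_f.
Qed.

End BasisMatrix.

(** Integer matrices of [A] and of its left inverse [B] multiply to the identity, because
    coordinates in a free family are unique and the integers embed in [C]. *)
Lemma preserves_of_inverse (C : numFieldType) (V : vectType C) (I : finType)
    (e : I -> V) (A B : 'End(V)) :
  free [seq e i | i : I] -> cancel A B ->
  (forall i, comb_of (intr : {rmorphism int -> C}) e (A (e i))) ->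
  (forall i, comb_of (intr : {rmorphism int -> C}) e (B (e i))) ->
  preserves_Zbasis A e.
Proof.
move=> e_free AB /fin_all_exists[M AE] /fin_all_exists[N BE].
have NM i l : \sum_k M i k * N k l = (l == i)%:R.
  apply: (@intr_inj C); apply/eqP; rewrite -subr_eq0; apply/eqP; move: l.
  apply: free_coef0 e_free _.
  under eq_bigr => l _ do rewrite scalerBl.
  rewrite sumrB; apply/eqP; rewrite subr_eq0; apply/eqP.
  transitivity (e i); last first.
    rewrite (bigD1 i) //= eqxx scale1r big1 ?addr0 // => l /negPf->.
    by rewrite scale0r.
  rewrite -[RHS]AB AE linear_sum /=.
  under [RHS]eq_bigr => k _ do rewrite linearZ /= BE scaler_sumr.
  rewrite exchange_big; apply: eq_bigr => l _.
  rewrite rmorph_sum scaler_suml; apply: eq_bigr => k _.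
  by rewrite scalerA rmorphM.
(* Here [L i k] is the coefficient of [e k] in the image of [e i]; images are stored in columns,
   hence the transposition. *)
pose toM (L : I -> I -> int) : 'M[int]_#|I| :=
  \matrix_(i, j) L (enum_val j) (enum_val i).
have NM1 : toM N *m toM M = 1%:M.
  apply/matrixP => l i; rewrite !mxE.
  rewrite -(inj_eq enum_val_inj) -NM.
  rewrite (big_enum_val (A := predT) (fun k => M _ k * N k _)).
  by apply: eq_bigr => k _; rewrite !mxE mulrC.
exists (toM M); first by have [] := mulmx1_unit NM1.
move=> j; rewrite AE (big_enum_val (A := predT) (fun k => _ *: e k)).
by apply: eq_bigr => i _; rewrite mxE.
Qed.

(** * Coordinates of the script vectors and the basis property *)

Section Zvec.

Variables (C : fieldType) (p q r : nat).
Variables (la : 'I_p -> C) (mu : 'I_q -> C) (nu : 'I_r -> C).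

Local Notation vec := (nspace C p q r).
Implicit Types (x y : vec).

Definition Zcoef (a b : beta p q r) : C :=
  match a, b with
  | BX m l s, BX i j k => la i ^+ m * mu j ^+ l * nu k ^+ s
  | BY l, BY j => (mu j)^-1 ^+ l
  | BZ s, BZ k => (nu k)^-1 ^+ s
  | BV m s, BV i k => la i ^+ m * nu k ^+ s
  | BW m l, BW i j => la i ^+ m * mu j ^+ l
  | BU m, BU i => la i ^+ m
  | _, _ => 0
  end.

Lemma crd_Zvec a b : crd (Zvec la mu nu a) b = Zcoef a b.
Proof.
rewrite -[RHS]crd_lincomb; congr (crd _ b); symmetry.
case: a => [i j k|j|k|i k|i j|i].
- by rewrite big_betaX // => -[]//= *; rewrite scale0r.
- rewrite big_betaY; last by case=> //= *; rewrite scale0r.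
  by apply: eq_bigr => m _; rewrite /= exprVn.
- rewrite big_betaZ; last by case=> //= *; rewrite scale0r.
  by apply: eq_bigr => m _; rewrite /= exprVn.
- by rewrite big_betaV // => -[]//= *; rewrite scale0r.
- by rewrite big_betaW // => -[]//= *; rewrite scale0r.
- by rewrite big_betaU // => -[]//= *; rewrite scale0r.
Qed.

Section Criterion.

Variables (K0 : comNzRingType) (phi : {rmorphism K0 -> C}).

(** Being a combination of script vectors is tested family by family, through expansions in the
    powers that define each family; [BY] and [BZ] call for powers of the inverses. *)
Lemma comb_of_Zvec x :
  power_comb3 phi la mu nu (fun i j k => crd x (BX i j k)) ->
  power_comb phi (fun j => (mu j)^-1) (fun j => crd x (BY j)) ->
  power_comb phi (fun k => (nu k)^-1) (fun k => crd x (BZ k)) ->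
  power_comb2 phi la nu (fun i k => crd x (BV i k)) ->
  power_comb2 phi la mu (fun i j => crd x (BW i j)) ->
  power_comb phi la (fun i => crd x (BU i)) ->
  comb_of phi (Zvec la mu nu) x.
Proof.
move=> [cX xX] [cY xY] [cZ xZ] [cV xV] [cW xW] [cU xU].
exists (fun b => match b with
  | BX i j k => cX i j k | BY j => cY j | BZ k => cZ k
  | BV i k => cV i k | BW i j => cW i j | BU i => cU i end).
apply: crdP => b; rewrite crd_sum.
under eq_bigr => a _ do rewrite crdZ crd_Zvec.
case: b => [i j k|j|k|i k|i j|i].
- by rewrite big_betaX // => -[]//= *; rewrite mulr0.
- by rewrite big_betaY // => -[]//= *; rewrite mulr0.
- by rewrite big_betaZ // => -[]//= *; rewrite mulr0.
- by rewrite big_betaV // => -[]//= *; rewrite mulr0.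
- by rewrite big_betaW // => -[]//= *; rewrite mulr0.
- by rewrite big_betaU // => -[]//= *; rewrite mulr0.
Qed.

End Criterion.

(** Lagrange interpolation in each index, multiplied over the indices, writes every vector of the
    original basis as a combination of script vectors. *)
Lemma Zvec_basis : injective la -> injective mu -> injective nu ->
  basis_of fullv [seq Zvec la mu nu a | a : beta p q r].
Proof.
move=> la_inj mu_inj nu_inj.
have muV_inj : injective (fun j => (mu j)^-1) by move=> i j /invr_inj/mu_inj.
have nuV_inj : injective (fun k => (nu k)^-1) by move=> i j /invr_inj/nu_inj.
have dla := power_comb_delta la_inj; have dmu := power_comb_delta mu_inj.
have dnu := power_comb_delta nu_inj.
have dmuV := power_comb_delta muV_inj; have dnuV := power_comb_delta nuV_inj.
apply: (@basis_of_comb _ _ _ _ (@bvec C p q r)).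
  have sp : fullv = crdspace C (predT : pred (beta p q r)).
    by apply/esym/vspaceP => x; rewrite memvf; apply/crdspaceP.
  rewrite basisEfree free_bvec ?enum_uniq // subvf /= [X in \dim X]sp.
  by rewrite dim_crdspace size_image.
case=> [i0 j0 k0|j0|k0|i0 k0|i0 j0|i0]; apply: comb_of_Zvec;
  try by [apply: power_comb0 => ?; rewrite crd_bvec
         |apply: power_comb2_0 => ? ?; rewrite crd_bvec
         |apply: power_comb3_0 => ? ? ?; rewrite crd_bvec].
- apply: power_comb3_ext (power_comb3M (dla i0) (dmu j0) (dnu k0)) => i j k.
  by rewrite crd_bvec -!natrM !mulnb.
- by apply: power_comb_ext (dmuV j0) => // j; rewrite crd_bvec.
- by apply: power_comb_ext (dnuV k0) => // k; rewrite crd_bvec.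
- apply: power_comb2_ext (power_comb2M (dla i0) (dnu k0)) => i k.
  by rewrite crd_bvec -!natrM !mulnb.
- apply: power_comb2_ext (power_comb2M (dla i0) (dmu j0)) => i j.
  by rewrite crd_bvec -!natrM !mulnb.
- by apply: power_comb_ext (dla i0) => // i; rewrite crd_bvec.
Qed.

End Zvec.

(** * Diagonal automorphisms *)

Section Diagonal.

Variables (C : fieldType) (p q r : nat).

Lemma crd_diag (d : beta p q r -> C) x b : crd (diag_end d x) b = d b * crd x b.
Proof. by rewrite /crd lfunE /= ffunE. Qed.

Variables (la : 'I_p -> C) (mu : 'I_q -> C) (nu : 'I_r -> C).

Lemma eigA_inv b :
  eigA (fun i => (la i)^-1) (fun j => (mu j)^-1) (fun k => (nu k)^-1) b
  = (eigA la mu nu b)^-1.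
Proof. by case: b => *; rewrite /= ?invfM. Qed.

Hypotheses (la0 : forall i, la i != 0) (mu0 : forall j, mu j != 0).
Hypothesis nu0 : forall k, nu k != 0.

Lemma eigA_neq0 b : eigA la mu nu b != 0.
Proof. by case: b => *; rewrite /= ?invr_eq0 ?mulf_neq0. Qed.

Lemma diag_eigAK :
  cancel (diag_end (eigA la mu nu))
    (diag_end (eigA (fun i => (la i)^-1) (fun j => (mu j)^-1)
                    (fun k => (nu k)^-1))).
Proof.
move=> x; apply: crdP => b.
by rewrite !crd_diag eigA_inv mulKf ?eigA_neq0.
Qed.

Lemma diag_eigAVK :
  cancel (diag_end (eigA (fun i => (la i)^-1) (fun j => (mu j)^-1)
                         (fun k => (nu k)^-1)))
    (diag_end (eigA la mu nu)).
Proof.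
move=> x; apply: crdP => b.
by rewrite !crd_diag eigA_inv mulVKf ?eigA_neq0.
Qed.

(** The eigenvalues are multiplicative along every nonzero bracket, for example (la_i mu_j nu_k)
    mu_j^-1 = la_i nu_k. *)
Lemma diag_eigA_automorphism :
  lie_automorphism (@nbracket C p q r) (diag_end (eigA la mu nu)).
Proof.
split; first by exists (diag_end (eigA (fun i => (la i)^-1)
   (fun j => (mu j)^-1) (fun k => (nu k)^-1)));
   [exact: diag_eigAK | exact: diag_eigAVK].
move=> x y; apply: crdP => b; rewrite crd_diag !nbracketE.
case: b => [i j k|j|k|i k|i j|i]; rewrite ?mulr0 //.
- rewrite mulr_sumr; apply: eq_bigr => j _; rewrite !crd_diag /=.
  by field; exact: mu0.
- rewrite mulr_sumr; apply: eq_bigr => k _; rewrite !crd_diag /=.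
  by field; exact: nu0.
rewrite mulrDr !mulr_sumr; congr (_ + _); apply: eq_bigr => m _;
  rewrite !crd_diag /=.
- by field; exact: nu0.
- by field; exact: mu0.
Qed.

End Diagonal.

(** An eigenvector has a nonzero coordinate, and comparing that coordinate identifies the eigenvalue
    with a diagonal entry. *)
Lemma diag_hyperbolic (C : numClosedFieldType) (p q r : nat)
    (d : beta p q r -> C) :
  (forall b, `|d b| != 1) -> hyperbolic (diag_end d).
Proof.
move=> d1 a; rewrite /passmx.leigenvalue -subv0 => /subvPn[x].
rewrite memv_ker memv0 => xa x0.
have [b xb] : exists b, crd x b != 0.
  apply/existsP; apply: contraNT x0; rewrite negb_exists => /forallP xb.
  by apply/eqP/crdP => b; rewrite crd0; apply/eqP; have := xb b; rewrite negbK.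
suff <- : d b = a by [].
apply: (mulIf xb); move: xa; rewrite add_lfunE opp_lfunE scale_lfunE id_lfunE subr_eq0.
move=> /eqP/(congr1 (fun y => crd y b)).
by rewrite /= crd_diag crdZ.
Qed.

(** * The integral basis *)

Section ZBasis.

Variables (C : numClosedFieldType) (p q r : nat).
Variables (la : 'I_p -> C) (mu : 'I_q -> C) (nu : 'I_r -> C).
Hypotheses (la_unit : unit_conjugates la) (mu_unit : unit_conjugates mu).
Hypothesis nu_unit : unit_conjugates nu.

Local Notation toC := (intr : {rmorphism int -> C}).
Local Notation e := (Zvec la mu nu).
Local Notation la0 := (unit_conjugates_neq0 la_unit).
Local Notation mu0 := (unit_conjugates_neq0 mu_unit).
Local Notation nu0 := (unit_conjugates_neq0 nu_unit).

(** Arbitrary integer exponents cover both the given map and the modified one that witnesses the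
    Anosov property; negating them gives the inverse. *)
Lemma preserves_Zvec (x y z : int) :
  preserves_Zbasis
    (diag_end (eigA (fun i => la i ^ x) (fun j => mu j ^ y)
                    (fun k => nu k ^ z))) e.
Proof.
have image_comb (s t u : int) (a : beta p q r) :
    comb_of toC e (diag_end (eigA (fun i => la i ^ s) (fun j => mu j ^ t)
                                  (fun k => nu k ^ u)) (e a)).
  have lax m : power_comb toC la (fun i => la i ^ s * la i ^+ m).
    apply: power_comb_ext (power_comb_exp la_unit (s + m%:Z)) => // i.
    by rewrite expfzDr ?la0.
  have muy m : power_comb toC mu (fun j => mu j ^ t * mu j ^+ m).
    apply: power_comb_ext (power_comb_exp mu_unit (t + m%:Z)) => // j.
    by rewrite expfzDr ?mu0.
  have nuz m : power_comb toC nu (fun k => nu k ^ u * nu k ^+ m).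
    apply: power_comb_ext (power_comb_exp nu_unit (u + m%:Z)) => // k.
    by rewrite expfzDr ?nu0.
  case: a => [m l s'|l|s'|m s'|m l|m]; apply: comb_of_Zvec;
    try by [apply: power_comb0 => ?; rewrite crd_diag crd_Zvec mulr0
           |apply: power_comb2_0 => ? ?; rewrite crd_diag crd_Zvec mulr0
           |apply: power_comb3_0 => ? ? ?; rewrite crd_diag crd_Zvec mulr0].
  - apply: power_comb3_ext (power_comb3M (lax m) (muy l) (nuz s')) => i j k.
    by rewrite crd_diag crd_Zvec /=; ring.
  (* The eigenvalue on Y_j is mu_j^(-t) and the script coefficient is mu_j^(-l); the exponents add
     up. *)
  - apply: power_comb_ext (power_comb_inv_exp mu_unit (- t - l%:Z)) => // j.
    by rewrite crd_diag crd_Zvec /= expfzDr ?mu0 // -!invr_expz exprVn.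
  - apply: power_comb_ext (power_comb_inv_exp nu_unit (- u - s'%:Z)) => // k.
    by rewrite crd_diag crd_Zvec /= expfzDr ?nu0 // -!invr_expz exprVn.
  - apply: power_comb2_ext (power_comb2M (lax m) (nuz s')) => i k.
    by rewrite crd_diag crd_Zvec /=; ring.
  - apply: power_comb2_ext (power_comb2M (lax m) (muy l)) => i j.
    by rewrite crd_diag crd_Zvec /=; ring.
  - by apply: power_comb_ext (lax m) => // i; rewrite crd_diag crd_Zvec.
apply: preserves_of_inverse (image_comb x y z) (image_comb (- x) (- y) (- z)).
  apply: basis_free; apply: Zvec_basis; exact: unit_conjugates_inj.
move=> v; apply: crdP => b.
rewrite !crd_diag; set d := (X in X * (_ * _)).
have -> : d = (eigA (fun i => la i ^ x) (fun j => mu j ^ y)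
                    (fun k => nu k ^ z) b)^-1.
  by rewrite -eigA_inv /d; case: b {d} => * /=; rewrite -?invr_expz.
by rewrite mulKf // eigA_neq0 // => *; rewrite expfz_neq0 ?(la0, mu0, nu0).
Qed.

(** The structure constants are traces: the half bracket of the script vectors X_(m,l,s) and Y_l' is
    V_(m,s) times the sum of the mu_j^(l-l'), and the other three nonzero cases are analogous. *)
Lemma half_coord_comb (a b : beta p q r) :
  comb_of toC e (\sum_c half_coord (e a) (e b) c *: bvec C c).
Proof.
have mutr (l l' : nat) :
    exists t : int, \sum_j mu j ^+ l * (mu j)^-1 ^+ l' = t%:~R.
  have [t tE] := trace_exp_int mu_unit (l%:Z - l'%:Z); exists t; rewrite -tE.
  by apply: eq_bigr => j _; rewrite expfzDr ?mu0 // -invr_expz exprVn.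
have nutr (s s' : nat) :
    exists t : int, \sum_k nu k ^+ s * (nu k)^-1 ^+ s' = t%:~R.
  have [t tE] := trace_exp_int nu_unit (s%:Z - s'%:Z); exists t; rewrite -tE.
  by apply: eq_bigr => k _; rewrite expfzDr ?nu0 // -invr_expz exprVn.
apply: comb_of_Zvec.
- by apply: power_comb3_0 => i j k; rewrite crd_lincomb.
- by apply: power_comb0 => j; rewrite crd_lincomb.
- by apply: power_comb0 => k; rewrite crd_lincomb.
- apply: (@power_comb2_ext _ _ _ _ _ _ _
    (fun i k => \sum_j Zcoef la mu nu a (BX i j k) * Zcoef la mu nu b (BY j))).
    move=> i k; rewrite crd_lincomb /=.
    by apply: eq_bigr => j _; rewrite !crd_Zvec.
  case: a => [m l s|l|s|m s|m l|m]; case: b => [m' l' s'|l'|s'|m' s'|m' l'|m'];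
    try by apply: power_comb2_0 => i k; apply: big1 => j _;
           rewrite /= (mul0r, mulr0).
  have [t tE] := mutr l l'.
  apply: power_comb2_ext (power_comb2Z t (power_comb2M
    (power_comb_expn _ la m) (power_comb_expn _ nu s))) => i k /=.
  by rewrite -tE mulr_suml; apply: eq_bigr => j _; ring.
- apply: (@power_comb2_ext _ _ _ _ _ _ _
    (fun i j => \sum_k Zcoef la mu nu a (BX i j k) * Zcoef la mu nu b (BZ k))).
    move=> i j; rewrite crd_lincomb /=.
    by apply: eq_bigr => k _; rewrite !crd_Zvec.
  case: a => [m l s|l|s|m s|m l|m]; case: b => [m' l' s'|l'|s'|m' s'|m' l'|m'];
    try by apply: power_comb2_0 => i j; apply: big1 => k _;
           rewrite /= (mul0r, mulr0).
  have [t tE] := nutr s s'.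
  apply: power_comb2_ext (power_comb2Z t (power_comb2M
    (power_comb_expn _ la m) (power_comb_expn _ mu l))) => i j /=.
  by rewrite -tE mulr_suml; apply: eq_bigr => k _; ring.
- apply: (@power_comb_ext _ _ _ _ la _
    (fun i => \sum_k Zcoef la mu nu a (BZ k) * Zcoef la mu nu b (BV i k)
            + \sum_j Zcoef la mu nu a (BY j) * Zcoef la mu nu b (BW i j))) => //.
    move=> i; rewrite crd_lincomb /=.
    by congr (_ + _); apply: eq_bigr => k _; rewrite !crd_Zvec.
  case: a => [m l s|l|s|m s|m l|m]; case: b => [m' l' s'|l'|s'|m' s'|m' l'|m'];
    try by apply: power_comb0 => i; rewrite !big1 ?addr0 // => k _;
           rewrite /= (mul0r, mulr0).
  + have [t tE] := mutr l' l.
    apply: power_comb_ext (power_combZ t (power_comb_expn _ la m')) => // i /=.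
    rewrite -tE mulr_suml [X in _ = X + _]big1 ?add0r => [|k _]; last by rewrite mul0r.
    by apply: eq_bigr => j _; ring.
  + have [t tE] := nutr s' s.
    apply: power_comb_ext (power_combZ t (power_comb_expn _ la m')) => // i /=.
    rewrite -tE mulr_suml [X in _ = _ + X]big1 ?addr0 => [|k _]; last by rewrite mul0r.
    by apply: eq_bigr => j _; ring.
Qed.

Lemma Zvec_Zbasis : Zbasis nbracket e.
Proof.
split; first by apply: Zvec_basis; exact: unit_conjugates_inj.
move=> a b; have -> : nbracket (e a) (e b) =
    \sum_c half_coord (e a) (e b) c *: bvec C c
    - \sum_c half_coord (e b) (e a) c *: bvec C c.
  by apply: crdP => c; rewrite nbracket_half crdD crdN !crd_lincomb.
exact: (comb_ofB (half_coord_comb a b) (half_coord_comb b a)).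
Qed.

End ZBasis.

(** For fixed [i] and [j], two exponents giving modulus 1 would give equal powers of [|w j|], a
    positive number other than 1, so they coincide. *)
Lemma exponent_avoiding_norm1 (C : numFieldType) (I J : finType)
    (v : I -> C) (w : J -> C) :
  (forall i, v i != 0) -> (forall j, w j != 0) -> (forall j, `|w j| != 1) ->
  exists n, (0 < n)%N /\ forall i j, `|v i * w j ^+ n| != 1.
Proof.
move=> v0 w0 w1.
have [|n [n0 nP]] := @avoid_finitely_many (I * J)%type
    (fun ij n => `|v ij.1 * w ij.2 ^+ n| == 1).
  move=> [i j] m n /= /eqP Em /eqP; rewrite -Em !normrM !normrX.
  have vi : `|v i| != 0 by rewrite normr_eq0.
  by move=> /(mulfI vi)/ieexprIn-> //; rewrite ?normr_gt0.
by exists n; split=> // i j; apply: (nP (i, j)).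
Qed.

Theorem mainTheorem3 (R : realType) (p q r : nat)
    (lambda mu nu : R[i])
    (la : 'I_p -> R[i]) (mu_ : 'I_q -> R[i]) (nu_ : 'I_r -> R[i])
    (lambda_unit : algebraic_unit lambda)
    (lambda_deg : degree_over_Q lambda p) (lambda_conj : conjugates lambda la)
    (mu_unit : algebraic_unit mu)
    (mu_deg : degree_over_Q mu q) (mu_conj : conjugates mu mu_)
    (nu_unit : algebraic_unit nu)
    (nu_deg : degree_over_Q nu r) (nu_conj : conjugates nu nu_)
    (la_neq1 : forall i, `|la i| != 1)
    (mu_neq1 : forall j, `|mu_ j| != 1)
    (nu_neq1 : forall k, `|nu_ k| != 1)
    (lamu_neq1 : forall i j, `|la i * mu_ j| != 1)
    (lanu_neq1 : forall i k, `|la i * nu_ k| != 1)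
    (munu_neq1 : forall j k, `|mu_ j * nu_ k| != 1) :
  let br := @nbracket R[i] p q r in
  let A := diag_end (eigA la mu_ nu_) in
  let e := Zvec la mu_ nu_ in
  [/\ lie_bracket br /\
        lie_type br [:: (p * q * r + q + r)%N; (p * r + p * q)%N; p],
      lie_automorphism br A /\
        ((forall i j k, `|la i * mu_ j * nu_ k| != 1) -> hyperbolic A),
      Zbasis br e /\ preserves_Zbasis A e
    & Anosov br].
Proof.
move=> br A e.
have lau : unit_conjugates la by exists lambda.
have muu : unit_conjugates mu_ by exists mu.
have nuu : unit_conjugates nu_ by exists nu.
have p0 := unit_conjugates_gt0 lau; have q0 := unit_conjugates_gt0 muu.
have r0 := unit_conjugates_gt0 nuu.
have la0 := unit_conjugates_neq0 lau; have mu0 := unit_conjugates_neq0 muu.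
have nu0 := unit_conjugates_neq0 nuu.
have br_lie : lie_bracket br := nbracket_lie _ _ _ _.
have eZ : Zbasis br e := Zvec_Zbasis lau muu nuu.
split.
- by split; [exact: br_lie | exact: nspace_lie_type].
- split; first exact: diag_eigA_automorphism.
  (* The extra hypothesis handles the X vectors; the other families follow from the moduli assumed
     in the theorem. *)
  move=> lamunu_neq1; apply: diag_hyperbolic.
  by case=> *; rewrite /= ?normfV ?invr_eq1.
- by split; [exact: eZ | exact: (preserves_Zvec lau muu nuu 1 1 1)].
(* The exponent n must be chosen for la_i mu_j nu_k^n on the X vectors and la_i nu_k^n on the V
   vectors; [v] collects the factors of nu_k^n there. On the Z vectors any positive n works. *)
pose v (x : 'I_p * 'I_q + 'I_p) :=
  match x with inl (i, j) => la i * mu_ j | inr i => la i end.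
have [|n [n0 nP]] := exponent_avoiding_norm1 (v := v) _ nu0 nu_neq1.
  by case=> [[i j]|i]; rewrite /= ?mulf_neq0.
split=> //.
exists (diag_end (eigA la mu_ (fun k => nu_ k ^+ n))); split.
- by apply: diag_eigA_automorphism => // k; rewrite expf_neq0.
- apply: diag_hyperbolic => -[i j k|j|k|i k|i j|i] //=.
  + exact: (nP (inl (i, j))).
  + by rewrite normfV invr_eq1.
  + by rewrite normfV invr_eq1 normrX ieexprn_weq1 // negb_or -lt0n n0 nu_neq1.
  + exact: (nP (inr i)).
exists (beta p q r), e; split=> //.
exact: (preserves_Zvec lau muu nuu 1 1 n%:Z).
Qed.
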